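(* Let $q<r$ be positive integers. Let $(\lambda^0,\dots,\lambda^s)$ with $q\ge\lambda^0\ge\dots\ge\lambda^s\ge0$ and $s$ even be a column partition of $r$ in a column of width $q$ (parts of size $0$ are allowed). Then the possible values of the linear correction, over all assignments of types $e,f$ to the parts, are exactly the numbers $$q-\lambda^0-\sum_{j=1}^{s/2}\pm(\lambda^{2j-1}-\lambda^{2j})$$ for all independent choices of signs. In particular, given a column of the form $(q,\dots,q,a_1,\dots,a_t)$ with $q\ge a_1\ge\dots\ge a_t\ge0$, with at least one part of size $q$ preceding $a_1$, and with $t$ such that the total number of parts is odd, the possible column dimensions (for either $\varepsilon\in\{1,-1\}$) are as follows, where $\beta_q=\sum_{j=1}^ta_j(q-a_j)$ is the column box dimension and all choices of signs occur. - If there is an even number of $q$'s (preceding $a_1$), the possible column dimensions are $\beta_q\pm(q-a_1)\pm(a_2-a_3)\pm\dots\pm(a_{t-1}-a_t)$. - If there is an odd number of $q$'s (preceding $a_1$), the possible column dimensions are $\beta_q\pm(a_1-a_2)\pm(a_3-a_4)\pm\dots\pm(a_{t-1}-a_t)$.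
   Context: For a column of width $q$ with parts $\lambda^j\le q$ of total sum $r$, assign to each part a type $e$ or $f$; let $e^0\ge e^1\ge\cdots$ and $f^0\ge f^1\ge\cdots$ be the type $e$ and type $f$ parts in decreasing order. The column box dimension is $rq-\sum_j(\lambda^j)^2$, the linear correction is $l=q-\sum_j(-1)^je^j-\sum_j(-1)^jf^j$, and the column dimension, for $\varepsilon\in\{1,-1\}$, is $rq-\sum_j(\lambda^j)^2-\varepsilon l$. The two types play symmetric roles here. *)

(* Defs.v *)
From HB Require Import structures.
From mathcomp Require Import all_boot all_order all_algebra.
Set Implicit Arguments.
Unset Strict Implicit.
Unset Printing Implicit Defensive.
Import Order.TTheory GRing.Theory Num.Theory.
Local Open Scope ring_scope.

(* A column is the sequence of its parts; trailing parts of size 0 are kept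
   and counted.  The path condition reads q >= la^0 >= la^1 >= ... *)
Definition column_partition (q r : nat) (la : seq nat) : Prop :=
  path geq q la /\ sumn la = r.

(* One type per part: true stands for type e, false for type f. *)
Definition typing (la : seq nat) := (size la).-tuple bool.

Definition e_parts (la : seq nat) (T : typing la) : seq nat :=
  sort geq (mask T la).

Definition f_parts (la : seq nat) (T : typing la) : seq nat :=
  sort geq (mask (map negb T) la).

Definition alternating_sum (x : seq nat) : int :=
  \sum_(j < size x) (-1) ^+ j * (nth 0%N x j)%:Z.

Definition linear_correction (q : nat) (la : seq nat) (T : typing la) : int :=
  q%:Z - alternating_sum (e_parts T) - alternating_sum (f_parts T).

Definition column_box_dim (q : nat) (la : seq nat) : int :=
  (sumn la)%:Z * q%:Z - \sum_(x <- la) x%:Z ^+ 2.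

Definition column_dim (q : nat) (eps : int) (la : seq nat) (T : typing la)
    : int :=
  column_box_dim q la - eps * linear_correction q T.

(* Main.v *)
Require Import Defs.
From HB Require Import structures.
From mathcomp Require Import all_boot all_order all_algebra.
From mathcomp Require Import zify ring.
Set Implicit Arguments.
Unset Strict Implicit.
Unset Printing Implicit Defensive.
Import Order.TTheory GRing.Theory Num.Theory.
Local Open Scope ring_scope.

(** Read the parts in decreasing order, recording the signs that the next part of
    type e and the next part of type f would receive in their alternating sums.
    The first part gets the sign +, whichever its type, and leaves the two
    recorded signs opposite.  From such a state the next part may receive either
    sign; this makes the two recorded signs equal, so the part after it is forced
    to get the opposite sign, and the state has opposite signs again.  Hence the
    parts after the first contribute signed differences of consecutive pairs. *)

Fixpoint signed_pair_sum (sg : nat -> bool) (l : seq nat) : int :=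
  if l is x :: y :: l' then
    (-1) ^+ sg 0%N * (x%:Z - y%:Z) + signed_pair_sum (sg \o S) l'
  else 0.

Lemma signed_pair_sum_eq (sg sg' : nat -> bool) (l : seq nat) :
  sg =1 sg' -> signed_pair_sum sg l = signed_pair_sum sg' l.
Proof.
(* Induction on a bound for the length, since the recursion removes two entries at a time. *)
have [n] := ubnP (size l); elim: n sg sg' l => // n IHn sg sg' [|x [|y l]] //=.
by move=> ltln eq_sg; rewrite eq_sg (IHn _ (sg' \o S)) // => [|j /=]; first lia.
Qed.

Lemma signed_pair_sum_addb (b : bool) (sg : nat -> bool) (l : seq nat) :
  signed_pair_sum (fun j => b (+) sg j) l = (-1) ^+ b * signed_pair_sum sg l.
Proof.
have [n] := ubnP (size l); elim: n sg l => // n IHn sg [|x [|y l]] /= ltln;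
  rewrite ?mulr0 //.
rewrite [RHS]mulrDr [X in _ = X + _]mulrA -signr_addb -IHn; last by lia.
by congr (_ + _); exact: signed_pair_sum_eq.
Qed.

Lemma signed_pair_sum_iota (sg : nat -> bool) (a : nat -> nat) (i p : nat) :
  signed_pair_sum sg [seq a j | j <- iota i p.*2] =
  \sum_(j < p) (-1) ^+ sg j * ((a (i + j.*2)%N)%:Z - (a (i + j.*2).+1)%:Z).
Proof.
elim: p sg i => [|p IHp] sg i /=; first by rewrite big_ord0.
rewrite big_ord_recl /= addn0 IHp; congr (_ + _); apply: eq_bigr => j _ /=.
by rewrite /bump /= add1n doubleS !addnS !addSn.
Qed.

Lemma signed_pair_sum_iota1 (sg : nat -> bool) (a : nat -> nat) (p : nat) :
  signed_pair_sum sg [seq a j | j <- iota 1 p.*2] =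
  \sum_(1 <= j < p.+1) (-1) ^+ sg j.-1
    * ((a (2 * j - 1)%N)%:Z - (a (2 * j)%N)%:Z).
Proof.
rewrite signed_pair_sum_iota big_add1 big_mkord; apply: eq_bigr => j _ /=.
by congr (_ * ((a _)%:Z - (a _)%:Z)); lia.
Qed.

Lemma signed_pair_sum_iota2 (sg : nat -> bool) (a : nat -> nat) (p : nat) :
  signed_pair_sum sg [seq a j | j <- iota 2 p.*2] =
  \sum_(1 <= j < p.+1) (-1) ^+ sg j.-1
    * ((a (2 * j)%N)%:Z - (a (2 * j + 1)%N)%:Z).
Proof.
rewrite signed_pair_sum_iota big_add1 big_mkord; apply: eq_bigr => j _ /=.
by congr (_ * ((a _)%:Z - (a _)%:Z)); lia.
Qed.

Definition pair_value (l : seq nat) (v : int) : Prop :=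
  exists sg : nat -> bool, v = signed_pair_sum sg l.

(** The set of values is closed under negation. This absorbs the sign changes caused by the types of
    earlier parts and by [eps]. *)
Lemma pair_value_sign (b : bool) (l : seq nat) (v : int) :
  pair_value l v -> pair_value l ((-1) ^+ b * v).
Proof.
by case=> sg ->; exists (fun j => b (+) sg j); rewrite signed_pair_sum_addb.
Qed.

Lemma pair_value_cons2 (x y : nat) (l : seq nat) (v : int) :
  pair_value (x :: y :: l) v <->
  exists b : bool,
    exists2 w, pair_value l w & v = (-1) ^+ b * (x%:Z - y%:Z) + w.
Proof.
split=> [[sg ->] | [b [w [sg ->] ->]]].
  by exists (sg 0%N); exists (signed_pair_sum (sg \o S) l) => //; exists (sg \o S).
exists (fun j => if j is j'.+1 then sg j' else b) => /=.
by congr (_ + _); apply: signed_pair_sum_eq.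
Qed.

(** Each pair of equal parts contributes a zero difference, so its sign is immaterial. *)
Lemma pair_value_nseq (n q : nat) (l : seq nat) (v : int) :
  pair_value (nseq n.*2 q ++ l) v <-> pair_value l v.
Proof.
elim: n v => [|n IHn] v //; rewrite doubleS /= pair_value_cons2 -IHn.
split=> [[b [w lw ->]] | lv]; first by rewrite subrr mulr0 add0r.
by exists false, v => //; rewrite subrr mulr0 add0r.
Qed.

Lemma alternating_sum_nil : alternating_sum [::] = 0.
Proof. exact: big_ord0. Qed.

Lemma alternating_sum_cons (x : nat) (s : seq nat) :
  alternating_sum (x :: s) = x%:Z - alternating_sum s.
Proof.
rewrite /alternating_sum /= big_ord_recl /= expr0 mul1r -sumrN; congr (_ + _).
by apply: eq_bigr => j _; rewrite /= exprS mulN1r mulNr.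
Qed.

(** Up to a global sign, this is what the remaining parts contribute whenever the next e-sign and
    the next f-sign are opposite. *)
Definition ef_difference (T : seq bool) (l : seq nat) : int :=
  alternating_sum (mask T l) - alternating_sum (mask (map negb T) l).

(** If [x] and [y] share a type, they alternate within it and leave both signs as they were. If
    their types differ, they receive opposite signs because the two sums are subtracted, and each
    sum is shifted by one place, which negates the tail. *)
Lemma ef_difference_cons2 (b c : bool) (T : seq bool) (x y : nat) (l : seq nat) :
  ef_difference [:: b, c & T] [:: x, y & l] =
  (-1) ^+ (~~ b) * (x%:Z - y%:Z) + (-1) ^+ (b (+) c) * ef_difference T l.
Proof.
by rewrite /ef_difference; case: b; case: c => /=;
  rewrite !alternating_sum_cons ?expr0 ?expr1; ring.
Qed.

Lemma ef_difference_values (k : nat) (l : seq nat) (v : int) :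
  size l = k.*2 ->
  (exists2 T : seq bool, size T = size l & ef_difference T l = v) <->
  pair_value l v.
Proof.
elim: k l v => [|k IHk] [|x [|y l]] v //=.
  move=> _; split=> [[T /size0nil-> <-] | [sg ->]].
    by exists xpred0; rewrite /ef_difference alternating_sum_nil subrr.
  by exists [::]; rewrite // /ef_difference alternating_sum_nil subrr.
rewrite doubleS => -[sz_l]; rewrite pair_value_cons2; split.
  case=> -[|b [|c T]] //= [sz_T] <-; rewrite ef_difference_cons2.
  exists (~~ b), ((-1) ^+ (b (+) c) * ef_difference T l) => //.
  by apply: pair_value_sign; apply/(IHk _ _ sz_l); exists T.
case=> b [w /(IHk _ _ sz_l)[T sz_T <-] ->].
(* Giving both parts the same type leaves the tail unflipped, and that type alone fixes the sign of
   the difference. *)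
exists [:: ~~ b, ~~ b & T]; first by rewrite /= sz_T.
by rewrite ef_difference_cons2 negbK addbb mul1r.
Qed.

Lemma sort_mask_geq (q : nat) (T : seq bool) (l : seq nat) :
  path geq q l -> sort geq (mask T l) = mask T l.
Proof.
move=> /path_sorted l_sorted.
have geq_trans : transitive geq by move=> y x z /= yx zy; exact: leq_trans zy yx.
by apply: sorted_sort => //; apply: sorted_mask.
Qed.

(** The first part uses up the leading sign of its own type. From then on the two types carry
    opposite signs, and the choice of [b] decides which is positive. *)
Lemma linear_correction_cons (q x : nat) (l : seq nat) (T : typing (x :: l))
    (b : bool) (T' : seq bool) :
  path geq q (x :: l) -> T = b :: T' :> seq bool ->
  linear_correction q T = q%:Z - x%:Z + (-1) ^+ (~~ b) * ef_difference T' l.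
Proof.
move=> srt defT; rewrite /linear_correction /e_parts /f_parts.
rewrite !(sort_mask_geq _ srt) defT /ef_difference.
by case: b {defT} => /=; rewrite alternating_sum_cons ?expr0 ?expr1; ring.
Qed.

Lemma linear_correction_values (q x k : nat) (l : seq nat) (v : int) :
  path geq q (x :: l) -> size l = k.*2 ->
  (exists T : typing (x :: l), linear_correction q T = v) <->
  exists2 w, pair_value l w & v = q%:Z - x%:Z - w.
Proof.
move=> srt sz_l; split=> [[T <-] | [w /(ef_difference_values _ sz_l)[T' sz_T <-] ->]].
  case defT: (T : seq bool) (size_tuple T) => [|b T'] //= [sz_T].
  exists ((-1) ^+ b * ef_difference T' l).
    by apply: pair_value_sign; apply/(ef_difference_values _ sz_l); exists T'.
  by rewrite (linear_correction_cons srt defT); case: b {defT}; ring.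
(* Type f for the first part makes the tail enter with a minus sign, matching [- w]. *)
have sz_fT : size (false :: T') == size (x :: l) by rewrite /= sz_T.
exists (Tuple sz_fT); rewrite (@linear_correction_cons _ _ _ _ false T') //.
by rewrite expr1 mulN1r.
Qed.

Lemma column_box_dimE (q : nat) (l : seq nat) :
  column_box_dim q l = \sum_(x <- l) x%:Z * (q%:Z - x%:Z).
Proof.
rewrite /column_box_dim; elim: l => [|x l IHl]; first by rewrite !big_nil mul0r subrr.
by rewrite !big_cons -IHl /= PoszD; ring.
Qed.

(** The first part [q] cancels the constant [q] of the correction. What remains takes a set of
    values closed under negation, so [eps] has no effect on it. *)
Lemma column_dim_values (q n k : nat) (l : seq nat) (eps v : int) :
  path geq q (q :: nseq n.*2 q ++ l) -> size l = k.*2 -> eps = 1 \/ eps = -1 ->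
  (exists T : typing (q :: nseq n.*2 q ++ l), column_dim q eps T = v) <->
  exists2 w, pair_value l w
    & v = column_box_dim q (q :: nseq n.*2 q ++ l) + w.
Proof.
set col := _ :: _ => srt sz_l eps_sign.
have [b epsE]: exists b : bool, eps = (-1) ^+ b.
  by case: eps_sign => ->; [exists false | exists true].
have sz : size (nseq n.*2 q ++ l) = (n + k).*2 by rewrite size_cat size_nseq sz_l doubleD.
have val := linear_correction_values _ srt sz.
split=> [[T <-] | [w lw ->]].
  have [w lw eqw] := (val _).1 (ex_intro _ T erefl).
  exists ((-1) ^+ b * w); first by apply: pair_value_sign; exact: (pair_value_nseq n q l w).1 lw.
  by rewrite /column_dim eqw epsE; ring.
(* The correction [c] needed satisfies [- eps * c = w], and [eps] is its own inverse. *)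
have [|T eqT] := (val (- ((-1) ^+ b * w))).2.
  exists ((-1) ^+ b * w); last by ring.
  by apply: pair_value_sign; apply/pair_value_nseq.
by exists T; rewrite /column_dim eqT epsE mulrN opprK signrMK.
Qed.

Theorem lemma4p4 (q r : nat) (hq : (0 < q)%N) (hqr : (q < r)%N) :
  (forall (s : nat) (la : nat -> nat),
      ~~ odd s ->
      column_partition q r (mkseq la s.+1) ->
      forall v : int,
        (exists T : typing (mkseq la s.+1), linear_correction q T = v) <->
        (exists sg : nat -> bool,
            v = q%:Z - (la 0%N)%:Z
                - \sum_(1 <= j < (s./2).+1)
                    (-1) ^+ sg j * ((la (2 * j - 1)%N)%:Z - (la (2 * j)%N)%:Z)))
  /\
  (forall (m t : nat) (a : nat -> nat),
      (0 < m)%N ->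
      odd (m + t) ->
      let col := nseq m q ++ [seq a j | j <- iota 1 t] in
      let beta : int :=
        \sum_(1 <= j < t.+1) (a j)%:Z * (q%:Z - (a j)%:Z) in
      column_partition q r col ->
      [/\ column_box_dim q col = beta,
          (~~ odd m ->
           forall eps : int, eps = 1 \/ eps = -1 ->
           forall v : int,
             (exists T : typing col, column_dim q eps T = v) <->
             (exists sg : nat -> bool,
                 v = beta + (-1) ^+ sg 0%N * (q%:Z - (a 1%N)%:Z)
                     + \sum_(1 <= j < (t./2).+1)
                         (-1) ^+ sg j
                         * ((a (2 * j)%N)%:Z - (a (2 * j + 1)%N)%:Z)))
        & (odd m ->
           forall eps : int, eps = 1 \/ eps = -1 ->
           forall v : int,
             (exists T : typing col, column_dim q eps T = v) <->
             (exists sg : nat -> bool,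
                 v = beta
                     + \sum_(1 <= j < (t./2).+1)
                         (-1) ^+ sg j
                         * ((a (2 * j - 1)%N)%:Z - (a (2 * j)%N)%:Z)))]).
Proof.
split=> [s la s_even [srt _] v | m t a m_gt0 mt_odd col beta [srt _]].
  have defs : s = s./2.*2 by rewrite -[LHS](odd_double_half s) (negbTE s_even).
  have sz : size [seq la j | j <- iota 1 s] = s./2.*2 by rewrite size_map size_iota.
  rewrite (linear_correction_values v srt sz) defs half_double.
  split=> [[w [sg ->] ->] | [sg ->]].
    (* Pairs are numbered from 1 in the sum but signs from 0 in [signed_pair_sum], hence the
       shift. *)
    by exists (sg \o predn); rewrite signed_pair_sum_iota1.
  exists (signed_pair_sum (sg \o S) [seq la j | j <- iota 1 s./2.*2]).
    by exists (sg \o S).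
  rewrite signed_pair_sum_iota1; congr (_ - _).
  (* The sign functions [sg \o S \o predn] and [sg] may differ only at 0, which lies outside the
     range. *)
  by apply: eq_big_nat => -[|j].
have boxE : column_box_dim q col = beta.
  rewrite column_box_dimE big_cat big_map /= big1_seq ?add0r.
    by rewrite /beta /index_iota subn1.
  by move=> x /nseqP[-> _]; rewrite subrr mulr0.
split=> // [m_even | m_odd] eps eps_sign v.
(* Of the even number of parts [q], one is the first part, [n] pairs cancel, and the last one is
   paired with [a 1]. This is where the term [q - a 1] comes from. *)
- have [n defm] : exists n, m = n.*2.+2 by exists m./2.-1; lia.
  have [p deft] : exists p, t = p.*2.+1 by exists t./2; lia.
  have colE : col = q :: nseq n.*2 q ++ (q :: a 1%N :: [seq a j | j <- iota 2 p.*2]).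
    rewrite /col defm deft /=; congr (_ :: _).
    by elim: (n.*2) => //= i ->.
  have sz : size (q :: a 1%N :: [seq a j | j <- iota 2 p.*2]) = p.+1.*2.
    by rewrite /= size_map size_iota.
  rewrite -boxE; rewrite colE in srt *.
  rewrite (column_dim_values v srt sz eps_sign) deft /= uphalf_double.
  split=> [[w [sg ->] ->] | [sg ->]].
    (* No shift here: [sg 0] is the sign of the pair formed by [q] and [a 1]. *)
    exists sg; rewrite /= addrA signed_pair_sum_iota2; congr (_ + _).
    by apply: eq_big_nat => -[|j].
  eexists; first by exists sg.
  rewrite /= addrA signed_pair_sum_iota2; congr (_ + _).
  by apply: eq_big_nat => -[|j].
(* After the first part the other parts [q] pair off among themselves, so the pairing of the rest
   starts at [a 1]. *)
have [n defm] : exists n, m = n.*2.+1 by exists m./2; lia.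
have [p deft] : exists p, t = p.*2 by exists t./2; lia.
have colE : col = q :: nseq n.*2 q ++ [seq a j | j <- iota 1 p.*2].
  by rewrite /col defm deft.
have sz : size [seq a j | j <- iota 1 p.*2] = p.*2 by rewrite size_map size_iota.
rewrite -boxE; rewrite colE in srt *.
rewrite (column_dim_values v srt sz eps_sign) deft half_double.
split=> [[w [sg ->] ->] | [sg ->]].
  by exists (sg \o predn); rewrite signed_pair_sum_iota1.
exists (signed_pair_sum (sg \o S) [seq a j | j <- iota 1 p.*2]).
  by exists (sg \o S).
rewrite signed_pair_sum_iota1; congr (_ + _).
by apply: eq_big_nat => -[|j].
Qed.
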